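(* Let $d\ge 1$ and $n\ge 0$ be integers. Assume that $f:\mathbb{R}^d\to\mathbb{R}$ is a continuous solution of $$a_0(h)f(x)+a_1(h)f(x+h)+\cdots+a_n(h)f(x+nh)=0\quad\text{for all } x\in\mathbb{R}^d \text{ and all } h\in U$$ for a certain open set $U\subseteq\mathbb{R}^d$ and certain continuous functions $a_k:U\to\mathbb{R}$, $k=0,\dots,n$, such that $a=(a_0,\dots,a_n)$ does not vanish identically on $U$. Then $f$ is an exponential polynomial in $d$ variables.
   Context: An exponential polynomial in $d$ variables is a function on $\mathbb{R}^d$ that is a finite complex linear combination of exponential monomials $x^{\alpha}e^{\langle x,\lambda\rangle}$, where $\alpha\in\mathbb{N}^d$ (with $0\in\mathbb{N}$), $\lambda\in\mathbb{C}^d$ and $\langle x,\lambda\rangle=\sum_{j=1}^d x_j\lambda_j$. *)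

(* Defs.v *)
From HB Require Import structures.
From mathcomp Require Import all_boot all_order all_algebra.
From mathcomp Require Import complex.
From mathcomp Require Import all_classical all_reals all_analysis.
Import Order.TTheory GRing.Theory Num.Theory.
Import numFieldNormedType.Exports.

Set Implicit Arguments.
Unset Strict Implicit.
Unset Printing Implicit Defensive.

Local Open Scope ring_scope.
Local Open Scope complex_scope.

(* The complex exponential: e^(a + bi) = e^a (cos b + i sin b). *)
Definition cexp (R : realType) (z : R[i]) : R[i] :=
  let: a +i* b := z in (expR a * cos b) +i* (expR a * sin b).

(* Bilinear, without conjugation. *)
Definition pairing (R : realType) (d : nat) (x : 'rV[R]_d) (l : 'rV[R[i]]_d) :
    R[i] :=
  \sum_(j < d) (x 0 j)%:C * l 0 j.

Definition exp_monomial (R : realType) (d : nat) (alpha : 'I_d -> nat)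
    (l : 'rV[R[i]]_d) (x : 'rV[R]_d) : R[i] :=
  (\prod_(j < d) (x 0 j)%:C ^+ alpha j) * cexp (pairing x l).

Definition exponential_polynomial (R : realType) (d : nat)
    (g : 'rV[R]_d -> R[i]) : Prop :=
  exists (N : nat) (c : 'I_N -> R[i]) (alpha : 'I_N -> 'I_d -> nat)
         (l : 'I_N -> 'rV[R[i]]_d),
    forall x, g x = \sum_(i < N) c i * exp_monomial (alpha i) (l i) x.

(* Main.v *)
Require Import Defs.
From HB Require Import structures.
From mathcomp Require Import all_boot all_order all_algebra.
From mathcomp Require Import complex.
From mathcomp Require Import all_classical all_reals all_analysis.
From mathcomp Require Import ring lra.
Import Order.TTheory GRing.Theory Num.Theory.
Import numFieldNormedType.Exports.
Local Open Scope classical_set_scope.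
Local Open Scope ring_scope.
Local Open Scope complex_scope.

Set Implicit Arguments.
Unset Strict Implicit.
Unset Printing Implicit Defensive.

(* Near a point where [a] does not vanish, every step [h] gives a nontrivial
   linear recurrence for [f].  Finitely many such steps therefore put [f] in a
   finite-dimensional space of continuous functions stable under these steps;
   evaluating at points which separate that space shows that it is stable under
   the closed subgroup they generate.  Taking the steps [h0], [h0 + del e_j] and
   [h0 + sqrt 2 del e_j], this subgroup is everything.  On the space, translation
   along each axis is a continuous one-parameter matrix group, hence
   differentiable, and by Cayley-Hamilton its entries solve linear ODEs with
   constant coefficients, i.e. are exponential polynomials. *)

(** * Calculus of complex-valued functions of a real variable *)

Local Notation cRe := complex.Re.
Local Notation cIm := complex.Im.

(** Differentiation is taken componentwise, so that the real rules for [is_derive] apply to each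
    part. *)
Definition is_cderive (R : realType) (g : R -> R[i]) (t : R) (g' : R[i]) :=
  is_derive t 1 (fun s => cRe (g s)) (cRe g') /\
  is_derive t 1 (fun s => cIm (g s)) (cIm g').

Lemma is_cderive_cst (R : realType) (c : R[i]) (t : R) :
  is_cderive (fun=> c) t 0.
Proof. by split; apply: is_derive_cst. Qed.

Lemma is_cderiveD (R : realType) (f g : R -> R[i]) (t : R) (f' g' : R[i]) :
  is_cderive f t f' -> is_cderive g t g' ->
  is_cderive (fun s => f s + g s) t (f' + g').
Proof.
move=> [fr fi] [gr gi]; split.
- have := is_deriveD fr gr; rewrite -raddfD /=.
  by congr (is_derive _ _ _ _); apply/funext => s; rewrite fctE -raddfD.
- have := is_deriveD fi gi; rewrite -raddfD /=.
  by congr (is_derive _ _ _ _); apply/funext => s; rewrite fctE -raddfD.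
Qed.

Lemma is_cderiveM (R : realType) (f g : R -> R[i]) (t : R) (f' g' : R[i]) :
  is_cderive f t f' -> is_cderive g t g' ->
  is_cderive (fun s => f s * g s) t (f' * g t + f t * g').
Proof.
move=> [fr fi] [gr gi]; split.
- have := is_deriveB (is_deriveM fr gr) (is_deriveM fi gi).
  have -> : (fun s => cRe (f s)) * (fun s => cRe (g s)) -
      (fun s => cIm (f s)) * (fun s => cIm (g s)) = (fun s => cRe (f s * g s)).
    by apply/funext => s; rewrite !fctE; case: (f s) (g s) => ? ? [].
  move=> /is_derive_eq; apply.
  case: f' g' (f t) (g t) {fr fi gr gi} => a b [c d] [x y] [z w] /=.
  by rewrite /GRing.scale /=; ring.
- have := is_deriveD (is_deriveM fr gi) (is_deriveM fi gr).
  have -> : (fun s => cRe (f s)) * (fun s => cIm (g s)) +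
      (fun s => cIm (f s)) * (fun s => cRe (g s)) = (fun s => cIm (f s * g s)).
    by apply/funext => s; rewrite !fctE; case: (f s) (g s) => ? ? [].
  move=> /is_derive_eq; apply.
  case: f' g' (f t) (g t) {fr fi gr gi} => a b [c d] [x y] [z w] /=.
  by rewrite /GRing.scale /=; ring.
Qed.

Lemma is_cderive_eq (R : realType) (g : R -> R[i]) (t : R) (g1 g2 : R[i]) :
  is_cderive g t g1 -> g1 = g2 -> is_cderive g t g2.
Proof. by move=> + <-. Qed.

Lemma is_cderiveZ (R : realType) (c : R[i]) (g : R -> R[i]) (t : R) g' :
  is_cderive g t g' -> is_cderive (fun s => c * g s) t (c * g').
Proof.
by move=> dg; apply: is_cderive_eq (is_cderiveM (is_cderive_cst c t) dg) _; ring.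
Qed.

Lemma is_cderive_sum (R : realType) (I : Type) (r : seq I)
    (g : I -> R -> R[i]) (t : R) (g' : I -> R[i]) :
  (forall k, is_cderive (g k) t (g' k)) ->
  is_cderive (fun s => \sum_(k <- r) g k s) t (\sum_(k <- r) g' k).
Proof.
move=> dg; elim: r => [|k r IH].
  under [X in is_cderive X]eq_fun do rewrite big_nil.
  by rewrite big_nil; exact: is_cderive_cst.
under [X in is_cderive X]eq_fun do rewrite big_cons.
by rewrite big_cons; exact: is_cderiveD.
Qed.

Lemma is_cderive_real (R : realType) (g : R -> R) (t g' : R) :
  is_derive t 1 g g' -> is_cderive (fun s => (g s)%:C) t g'%:C.
Proof. by move=> dg; split=> //=; apply: is_derive_cst. Qed.

Lemma is_cderive_Xn (R : realType) (k : nat) (t : R) :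
  is_cderive (fun s => s%:C ^+ k) t (k%:R * t%:C ^+ k.-1).
Proof.
elim: k => [|k IH].
  by apply: is_cderive_eq (is_cderive_cst 1 t) _; rewrite mul0r.
have := is_cderiveM (is_cderive_real (is_derive_id t 1)) IH.
under [X in is_cderive X]eq_fun do rewrite -exprS.
move=> /is_cderive_eq; apply => /=.
(* At [k = 0] the predecessor truncates to 0 and [t * t ^+ k.-1] is not [t ^+ k]; there the factor
   [k%:R] kills the term. *)
case: k {IH} => [|k]; first by rewrite !expr0 mul0r mulr0 addr0.
by rewrite /= (exprS _ k) -(natr1 k.+1); ring.
Qed.

Lemma cexpD (R : realType) (z w : R[i]) : cexp (z + w) = cexp z * cexp w.
Proof.
case: z w => [a b] [c d]; rewrite /cexp /=.
by simpc; rewrite expRD cosD sinD; congr (_ +i* _); ring.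
Qed.

Lemma cexp0 (R : realType) : cexp (0 : R[i]) = 1.
Proof. by rewrite /cexp /= expR0 cos0 sin0 mulr0 mulr1. Qed.

Lemma is_cderive_exp (R : realType) (l : R[i]) (t : R) :
  is_cderive (fun s => cexp (s%:C * l)) t (l * cexp (t%:C * l)).
Proof.
case: l => a b.
(* Factoring through real functions of [s] reduces the claim to the real chain and product rules. *)
have E s : cexp (s%:C * (a +i* b)) =
    (expR (s * a))%:C * ((cos (s * b))%:C + 'i%C * (sin (s * b))%:C).
  by rewrite /cexp; simpc.
under [X in is_cderive X]eq_fun do rewrite E.
have dlin c : is_derive t 1 (fun s : R => s * c) c.
  have := is_deriveM (is_derive_id t 1) (is_derive_cst c t 1).
  by move=> /is_derive_eq; apply; rewrite scaler0 add0r /GRing.scale /= mulr1.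
have de := is_derive1_comp (g := *%R^~ a) (is_derive_expR (t * a)) (dlin a).
have dc := is_derive1_comp (g := *%R^~ b) (is_derive_cos (t * b)) (dlin b).
have ds := is_derive1_comp (g := *%R^~ b) (is_derive_sin (t * b)) (dlin b).
have := is_cderiveM (is_cderive_real de)
  (is_cderiveD (is_cderive_real dc) (is_cderiveZ 'i%C (is_cderive_real ds))).
move=> /is_cderive_eq; apply; rewrite E /=; simpc.
by congr (_ +i* _); ring.
Qed.

Lemma is_cderive0_cst (R : realType) (g : R -> R[i]) :
  (forall t, is_cderive g t 0) -> forall s t, g s = g t.
Proof.
move=> dg s t; apply/eqP; rewrite eq_complex; apply/andP; split; apply/eqP.
- by apply: (@is_derive_0_is_cst _ (fun x => cRe (g x))) => x; have [] := dg x.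
- by apply: (@is_derive_0_is_cst _ (fun x => cIm (g x))) => x; have [] := dg x.
Qed.

(** * Exponential polynomials in one variable and first-order linear equations *)

Definition exponential_sum1 (R : realType) (g : R -> R[i]) : Prop :=
  exists s : seq (R[i] * nat * R[i]),
    forall t, g t = \sum_(m <- s) m.1.1 * t%:C ^+ m.1.2 * cexp (t%:C * m.2).

Lemma exponential_sum1_0 (R : realType) (g : R -> R[i]) :
  (forall t, g t = 0) -> exponential_sum1 g.
Proof. by move=> g0; exists [::] => t; rewrite big_nil. Qed.

Lemma exponential_sum1_monomial (R : realType) c k l :
  exponential_sum1 (fun t : R => c * t%:C ^+ k * cexp (t%:C * l)).
Proof. by exists [:: (c, k, l)] => t; rewrite big_seq1. Qed.

Lemma exponential_sum1D (R : realType) (g h : R -> R[i]) :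
  exponential_sum1 g -> exponential_sum1 h ->
  exponential_sum1 (fun t => g t + h t).
Proof.
move=> [s gE] [s' hE]; exists (s ++ s') => t.
by rewrite big_cat /= gE hE.
Qed.

(** In the resonant case [l = m] the degree rises by one. Otherwise [c / (m - l) * t ^+ k * e^(m t)]
    solves the equation up to a monomial of degree [k - 1], which induction on [k] absorbs. *)
Lemma particular_solution_monomial (R : realType) (l : R[i]) c k m :
  exists2 p : R -> R[i], exponential_sum1 p &
    forall t, is_cderive p t (l * p t + c * t%:C ^+ k * cexp (t%:C * m)).
Proof.
have [<-{m}|lm] := eqVneq l m.
  exists (fun t => c / k.+1%:R * t%:C ^+ k.+1 * cexp (t%:C * l)).
    exact: exponential_sum1_monomial.
  move=> t; have := is_cderiveM
    (is_cderiveZ (c / k.+1%:R) (is_cderive_Xn k.+1 t)) (is_cderive_exp l t).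
  move=> /is_cderive_eq; apply => /=.
  have : (k.+1%:R : R[i]) != 0 by rewrite pnatr_eq0.
  by move: k.+1%:R => K K0; field.
have lm0 : m - l != 0 by rewrite subr_eq0 eq_sym.
elim: k c => [|k IH] c.
  exists (fun t => c / (m - l) * t%:C ^+ 0 * cexp (t%:C * m)).
    exact: exponential_sum1_monomial.
  move=> t; have := is_cderiveM
    (is_cderiveZ (c / (m - l)) (is_cderive_Xn 0 t)) (is_cderive_exp m t).
  by move=> /is_cderive_eq; apply; rewrite /= expr0; field.
have [p ep dp] := IH (- (c / (m - l) * k.+1%:R)).
exists (fun t => p t + c / (m - l) * t%:C ^+ k.+1 * cexp (t%:C * m)).
  by apply: exponential_sum1D => //; exact: exponential_sum1_monomial.
move=> t; have := is_cderiveD (dp t) (is_cderiveM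
  (is_cderiveZ (c / (m - l)) (is_cderive_Xn k.+1 t)) (is_cderive_exp m t)).
by move=> /is_cderive_eq; apply => /=; field.
Qed.

Lemma particular_solution (R : realType) (l : R[i]) (h : R -> R[i]) :
  exponential_sum1 h ->
  exists2 p : R -> R[i], exponential_sum1 p &
    forall t, is_cderive p t (l * p t + h t).
Proof.
move=> [s hE]; elim: s h hE => [|[[c k] m] s IH] h hE.
  exists (fun=> 0); first exact: exponential_sum1_0.
  move=> t; rewrite hE big_nil mulr0 addr0; exact: is_cderive_cst.
have [p ep dp] := IH _ (fun t => erefl).
have [q eq dq] := particular_solution_monomial l c k m.
exists (fun t => q t + p t); first exact: exponential_sum1D.
move=> t; apply: is_cderive_eq (is_cderiveD (dq t) (dp t)) _.
by rewrite hE big_cons /=; ring.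
Qed.

(** With [p] a particular solution, [e^(- l t) (g t - p t)] has zero derivative, so [g] is [p] plus
    a constant multiple of [e^(l t)]. *)
Lemma exponential_sum1_ode (R : realType) (l : R[i]) (g h : R -> R[i]) :
  exponential_sum1 h -> (forall t, is_cderive g t (l * g t + h t)) ->
  exponential_sum1 g.
Proof.
move=> eh dg; have [p ep dp] := particular_solution l eh.
pose q t := cexp (t%:C * - l) * (g t + -1 * p t).
have q0 : forall s t, q s = q t.
  apply: is_cderive0_cst => t.
  have := is_cderiveM (is_cderive_exp (- l) t)
    (is_cderiveD (dg t) (is_cderiveZ (-1) (dp t))).
  by move=> /is_cderive_eq; apply; ring.
have -> : g = (fun t => q 0 * t%:C ^+ 0 * cexp (t%:C * l) + p t).
  apply/funext => t; rewrite (q0 0 t) /q expr0 mulr1 mulrAC -cexpD.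
  by rewrite -mulrDr addNr mulr0 cexp0; ring.
by apply: exponential_sum1D => //; exact: exponential_sum1_monomial.
Qed.

(** * Continuous one-parameter matrix groups *)

Lemma local_antiderivative (R : realType) (f : R -> R) (K : R) :
  continuous f ->
  exists F : R -> R, forall t, - K < t < K -> is_derive t 1 F (f t).
Proof.
move=> cf.
(* Integrating from [- K] keeps everything inside the compact interval from [- K] to [K], on which
   [f] is integrable. *)
exists (fun x => \int[lebesgue_measure]_(t in `[- K, x]) f t)%R => t /andP[Kt tK].
have fi : lebesgue_measure.-integrable `[- K, K] (EFin \o f).
  apply: continuous_compact_integrable; first exact: segment_compact.
  exact: continuous_subspaceT.
have [] := @continuous_FTC1 R f (BLeft (- K)) t K tK fi _ (cf t).
  by rewrite /Order.lt /= Kt.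
by move=> /derivableP dF; rewrite derive1E => E; rewrite -E.
Qed.

Lemma derive0_interval_cst (R : realType) (f : R -> R) (K : R) :
  (forall t, - K < t < K -> is_derive t 1 f 0) ->
  forall s t, - K < s < K -> - K < t < K -> f s = f t.
Proof.
move=> df s t; wlog st : s t / s <= t => [W sK tK|].
  by case/orP: (le_total s t) => ?; [|symmetry]; apply: W.
move=> /andP[Ks sK] /andP[Kt tK].
have inK x : x \in `[s, t] -> - K < x < K.
  by rewrite in_itv /= => /andP[sx xt]; rewrite (lt_le_trans Ks) //= (le_lt_trans xt).
have cf : {within `[s, t], continuous f}.
  apply: derivable_within_continuous => x xst.
  by have [] := df _ (inK x xst).
have [|c _] := @MVT_segment R f (fun=> 0) s t st _ cf.
  by move=> x xst; apply: df; apply: inK; apply: subset_itv_oo_cc.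
by rewrite mul0r => /subr0_eq ->.
Qed.


Lemma cvg_det (R : realType) (T : Type) (G : set_system T) (FG : Filter G) n
    (A : T -> 'M[R]_n) (B : 'M[R]_n) :
  (forall i j, A x i j @[x --> G] --> B i j) ->
  \det (A x) @[x --> G] --> \det B.
Proof.
move=> AB; apply: cvg_big => [|p _]; first exact: add_continuous.
apply: cvgM; first exact: cvg_cst.
by apply: cvg_big => [|i _]; [exact: mul_continuous | exact: AB].
Qed.

Lemma is_derive_addl (R : realType) (f : R -> R) (c t f' : R) :
  is_derive (c + t) 1 f f' -> is_derive t 1 (fun s => f (c + s)) f'.
Proof.
move=> df; have dc : is_derive t 1 (fun s => c + s) 1.
  apply: is_derive_eq (is_deriveD (is_derive_cst c t 1) (is_derive_id t 1)) _.
  by rewrite add0r.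
by have := is_derive1_comp (g := fun s => c + s) df dc; rewrite mulr1.
Qed.

(* The increments of an antiderivative [F] of [N] satisfy
   [F (t + s) - F t = N t (F s - F 0)] for small [s] and [t], and
   [(F s - F 0) / s] tends to [N 0 = 1]; so [N] is as smooth as [F]. *)
Lemma matrix_group_derivable0 (R : realType) n (N : R -> 'M[R]_n) :
  (forall i j, continuous (fun t => N t i j)) ->
  N 0 = 1%:M -> (forall s t, N (s + t) = N s *m N t) ->
  exists A : 'M[R]_n, forall i j, is_derive (0 : R) 1 (fun t => N t i j) (A i j).
Proof.
move=> cN N0 ND.
(* The bound 2 leaves room for [t + s] when [s] and [t] both lie between -1 and 1. *)
have /choice[F0 dF0] : forall ij : 'I_n * 'I_n, exists F : R -> R,
    forall t : R, - 2 < t < 2 -> is_derive t 1 F (N t ij.1 ij.2).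
  by move=> ij; apply: local_antiderivative.
pose F t := \matrix_(i, j) F0 (i, j) t.
have dF i j (t : R) : - 2 < t < 2 -> is_derive t 1 (fun s => F s i j) (N t i j).
  move=> /(dF0 (i, j)); rewrite [X in is_derive _ _ X](_ : _ = fun s => F s i j) //.
  by apply/funext => s; rewrite mxE.
have FD s t : - 1 < s < 1 -> - 1 < t < 1 ->
    F (t + s) - F t = N t *m (F s - F 0).
  move=> sK tK; apply/matrixP => i j.
  pose g s := F (t + s) i j - \sum_k N t i k * F s k j.
  have dg (u : R) : - 1 < u < 1 -> is_derive u 1 g 0.
    move=> uK; have dl : is_derive u 1 (fun s => F (t + s) i j) (N (t + u) i j).
      apply: (is_derive_addl (f := fun s => F s i j)).
      by apply: dF; lra.
    have dr : is_derive u 1 (\sum_(k < n) (N t i k *: (fun s => F s k j)))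
        (\sum_(k < n) N t i k * N u k j).
      by apply: is_derive_sum => k; apply: is_deriveZ; apply: dF; lra.
    have -> : g = (fun s => F (t + s) i j) -
        \sum_(k < n) (N t i k *: (fun s => F s k j)).
      by apply/funext => x; rewrite !fctE fct_sumE.
    by apply: is_derive_eq (is_deriveB dl dr) _; rewrite ND mxE subrr.
  have : g s = g 0 by apply: (derive0_interval_cst dg); lra.
  rewrite /g addr0 => gE.
  have E : F (t + s) i j - F t i j =
      \sum_k N t i k * F s k j - \sum_k N t i k * F 0 k j by lra.
  transitivity (F (t + s) i j - F t i j); first by rewrite !mxE.
  rewrite E -sumrB mxE; apply: eq_bigr => k _.
  by rewrite -mulrBr; congr (_ * _); rewrite !mxE.
(* Caratheodory's form of the derivative: the difference quotient of [F] at 0 extends continuously,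
   with value [N 0]. Hence its determinant tends to 1 and is nonzero at some small [e]. *)
have /choice[q0 q0P] : forall ij : 'I_n * 'I_n, exists q : R -> R,
    [/\ forall z, F0 ij z - F0 ij 0 = q z * (z - 0), {for 0, continuous q}
      & q 0 = N 0 ij.1 ij.2].
  by move=> ij; apply/is_derive1_caratheodory; apply: dF0; lra.
pose Q t := \matrix_(i, j) q0 (i, j) t.
have FQ t : F t - F 0 = t *: Q t.
  apply/matrixP => i j; have [E _ _] := q0P (i, j).
  by rewrite !mxE E subr0 mulrC.
have detQ : \det (Q t) @[t --> 0^'+] --> (1 : R).
  rewrite -(@det1 R n); apply: cvg_det => i j; have [_ cq qN] := q0P (i, j).
  rewrite -N0 -[N 0 i j]qN; under eq_fun do rewrite mxE.
  exact: cvg_at_right_filter.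
have [e [e0 e1 dQ]] : exists e : R, [/\ 0 < e, e < 1 & \det (Q e) != 0].
  near (0 : R)^'+ => e; exists e; split => //.
  by near: e; apply: (cvgr_neq0 _ detQ); exact: oner_neq0.
pose D := F e - F 0.
have uD : D \in unitmx.
  by rewrite unitmxE unitfE /D FQ detZ mulf_neq0 // expf_neq0 // gt_eqF.
(* Solving [FD] for [N t] expresses it through antiderivatives, which are differentiable. *)
have NE t : - 1 < t < 1 -> N t = (F (t + e) - F t) *m invmx D.
  by move=> tK; rewrite FD ?mulmxK //; lra.
(* The derivative of [F (t + e) - F t] at [t = 0] is [N e - N 0]. *)
exists ((N e - N 0) *m invmx D) => i j.
have -> : ((N e - N 0) *m invmx D) i j = \sum_k (N e i k - N 0 i k) * invmx D k j.
  by rewrite mxE; apply: eq_bigr => k _; rewrite !mxE.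
apply: (@near_eq_is_derive _ _ _
  (\sum_(k < n) (invmx D k j *: ((fun s => F (s + e) i k) - (fun s => F s i k))))).
  near=> t; rewrite fct_sumE (NE t); last first.
    have : t \in `](-1), 1[%R by near: t; apply: near_in_itvoo; rewrite in_itv /=; lra.
    by rewrite in_itv.
  by rewrite mxE; apply: eq_bigr => k _; rewrite !fctE !mxE mulrC.
apply: is_derive_sum => k; rewrite mulrC; apply: is_deriveZ; apply: is_deriveB.
  under [X in is_derive _ _ X]eq_fun do rewrite addrC.
  apply: (is_derive_addl (f := fun s => F s i k)).
  by rewrite addr0; apply: dF; lra.
by apply: dF; lra.
Unshelve. all: end_near. Qed.

(** Since [N s = N t *m N (s - t)], the derivative at [t] is [N t] times the derivative at 0. *)
Lemma matrix_group_derive (R : realType) n (N : R -> 'M[R]_n) :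
  (forall i j, continuous (fun t => N t i j)) ->
  N 0 = 1%:M -> (forall s t, N (s + t) = N s *m N t) ->
  exists A : 'M[R]_n, forall i j t,
    is_derive (t : R) 1 (fun t => N t i j) ((N t *m A) i j).
Proof.
move=> cN N0 ND; have [A dA] := matrix_group_derivable0 cN N0 ND.
exists A => i j t.
pose g : R -> R := \sum_(k < n) (N t i k *: (fun s => N s k j)).
have dg : is_derive (- t + t) 1 g ((N t *m A) i j).
  by rewrite addNr mxE; apply: is_derive_sum => k; apply: is_deriveZ.
have <- : (fun s => g (- t + s)) = (fun s => N s i j).
  by apply/funext => s; rewrite /g fct_sumE /= -{2}[s](addNKr t) ND mxE.
exact: is_derive_addl dg.
Qed.

(** Over [R[i]] the characteristic polynomial of the generator splits. Its linear factors can be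
    peeled off one at a time, each leaving a scalar first-order equation, and Cayley-Hamilton says
    that the full product vanishes. *)
Lemma matrix_group_exponential_sum1 (R : realType) n (N : R -> 'M[R]_n) :
  (forall i j, continuous (fun t => N t i j)) ->
  N 0 = 1%:M -> (forall s t, N (s + t) = N s *m N t) ->
  forall i j, exponential_sum1 (fun t => (N t i j)%:C).
Proof.
(* An empty matrix has no entries; size [n.+1] gives the ring structure used by [horner_mx]. *)
case: n N => [|n] N cN N0 ND; first by case.
have [A dA] := matrix_group_derive cN N0 ND.
pose CN t : 'M[R[i]]_n.+1 := map_mx (real_complex R) (N t).
pose CA : 'M[R[i]]_n.+1 := map_mx (real_complex R) A.
have dN i j (t : R) : is_cderive (fun t => CN t i j) t ((CN t *m CA) i j).
  have -> : (fun t => CN t i j) = (fun t => (N t i j)%:C).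
    by apply/funext => s; rewrite mxE.
  by rewrite -map_mxM mxE; apply: is_cderive_real.
have dNQ (Q : 'M[R[i]]_n.+1) i j (t : R) :
    is_cderive (fun t => (CN t *m Q) i j) t ((CN t *m CA *m Q) i j).
  under [X in is_cderive X]eq_fun do rewrite mxE.
  by rewrite mxE; apply: is_cderive_sum => k; rewrite mulrC;
    under [X in is_cderive X]eq_fun do rewrite mulrC; exact: is_cderiveZ.
have [r rE] := closed_field_poly_normal (char_poly CA).
(* The derivative of [CN t *m Q] is [z] times itself plus [CN t *m ((CA - z) *m Q)]. The matrix
   [(CA - z) *m Q] is annihilated by the remaining factors, so by induction the inhomogeneous term
   is an exponential sum. *)
have step (s : seq R[i]) (Q : 'M[R[i]]_n.+1) i j :
    horner_mx CA (\prod_(z <- s) ('X - z%:P)) *m Q = 0 ->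
    exponential_sum1 (fun t => (CN t *m Q) i j).
  elim: s Q i j => [|z s IH] Q i j.
    rewrite big_nil rmorph1 mul1mx => ->.
    by apply: exponential_sum1_0 => t; rewrite mulmx0 mxE.
  rewrite big_cons mulrC rmorphM /= -mulmxE -mulmxA => /IH E.
  apply: (exponential_sum1_ode (l := z) (E i j)) => t.
  apply: is_cderive_eq (dNQ Q i j t) _.
  rewrite rmorphB /= horner_mx_X horner_mx_C mulmxBl mul_scalar_mx.
  rewrite mulmxBr -scalemxAr mulmxA.
  by move: (CN t *m CA *m Q) (CN t *m Q) => X Y; rewrite !mxE; ring.
move=> i j.
have -> : (fun t => (N t i j)%:C) = (fun t => (CN t *m 1%:M) i j).
  by apply/funext => t; rewrite mulmx1 mxE.
apply: (step r); rewrite mulmx1.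
have := Cayley_Hamilton CA; rewrite rE (monicP (char_poly_monic CA)) scale1r.
exact.
Qed.

(** * The algebra of exponential polynomials in several variables *)

Lemma exp_monomialM (R : realType) d (a b : 'I_d -> nat) (l m : 'rV[R[i]]_d) x :
  exp_monomial a l x * exp_monomial b m x =
  exp_monomial (fun j => (a j + b j)%N) (l + m) x.
Proof.
rewrite /exp_monomial mulrACA -big_split /= -cexpD -big_split /=.
congr (_ * cexp _); first by apply: eq_bigr => j _; rewrite exprD.
by apply: eq_bigr => j _; rewrite mxE mulrDr.
Qed.

(** With lists in place of indexed families, sums become concatenations and products become lists of
    pairs. *)
Lemma exponential_polynomial_seqP (R : realType) d (g : 'rV[R]_d -> R[i]) :
  exponential_polynomial g <->
  exists s : seq (R[i] * ('I_d -> nat) * 'rV[R[i]]_d),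
    forall x, g x = \sum_(m <- s) m.1.1 * exp_monomial m.1.2 m.2 x.
Proof.
split=> [[N [c [a [l gE]]]]|[s gE]].
  exists [seq (c i, a i, l i) | i <- index_enum 'I_N] => x.
  by rewrite gE big_map.
pose t := in_tuple s.
exists (size s), (fun i => (tnth t i).1.1), (fun i => (tnth t i).1.2).
by exists (fun i => (tnth t i).2) => x; rewrite gE big_tnth.
Qed.

Lemma exponential_polynomial0 (R : realType) d :
  exponential_polynomial (fun _ : 'rV[R]_d => 0).
Proof.
by apply/exponential_polynomial_seqP; exists [::] => x; rewrite big_nil.
Qed.

Lemma exponential_polynomialD (R : realType) d (g h : 'rV[R]_d -> R[i]) :
  exponential_polynomial g -> exponential_polynomial h ->
  exponential_polynomial (fun x => g x + h x).
Proof.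
move=> /exponential_polynomial_seqP[s gE] /exponential_polynomial_seqP[t hE].
apply/exponential_polynomial_seqP; exists (s ++ t) => x.
by rewrite big_cat /= gE hE.
Qed.

Lemma exponential_polynomial_sum (R : realType) d (I : Type) (r : seq I)
    (g : I -> 'rV[R]_d -> R[i]) :
  (forall i, exponential_polynomial (g i)) ->
  exponential_polynomial (fun x => \sum_(i <- r) g i x).
Proof.
move=> eg; elim: r => [|i r IH].
  under [X in exponential_polynomial X]eq_fun do rewrite big_nil.
  exact: exponential_polynomial0.
under [X in exponential_polynomial X]eq_fun do rewrite big_cons.
exact: exponential_polynomialD.
Qed.

Lemma exponential_polynomialM (R : realType) d (g h : 'rV[R]_d -> R[i]) :
  exponential_polynomial g -> exponential_polynomial h ->
  exponential_polynomial (fun x => g x * h x).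
Proof.
move=> /exponential_polynomial_seqP[s gE] /exponential_polynomial_seqP[t hE].
apply/exponential_polynomial_seqP.
exists [seq (p.1.1 * q.1.1, fun j => (p.1.2 j + q.1.2 j)%N, p.2 + q.2)
       | p <- s, q <- t] => x.
rewrite big_allpairs_dep gE hE big_distrl /=; apply: eq_bigr => p _.
by rewrite big_distrr; apply: eq_bigr => q _; rewrite -exp_monomialM mulrACA.
Qed.

Lemma exponential_polynomial_coord (R : realType) d (g : R -> R[i]) (j : 'I_d) :
  exponential_sum1 g -> exponential_polynomial (fun x : 'rV[R]_d => g (x 0 j)).
Proof.
move=> [s gE]; apply/exponential_polynomial_seqP.
exists [seq (m.1.1, fun i => if i == j then m.1.2 else 0%N, m.2 *: delta_mx 0 j)
       | m <- s] => x.
rewrite gE big_map; apply: eq_bigr => -[[c k] l] _ /=.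
rewrite -mulrA; congr (_ * _); rewrite /exp_monomial; congr (_ * cexp _).
  rewrite (bigD1 j) //= eqxx big1 ?mulr1 // => i /negbTE ->.
  by rewrite expr0.
rewrite /pairing (bigD1 j) //= !mxE !eqxx mulr1 big1 ?addr0 // => i /negbTE ij.
by rewrite !mxE ij !mulr0.
Qed.

Lemma exponential_polynomial_cst (R : realType) d (c : R[i]) :
  exponential_polynomial (fun _ : 'rV[R]_d => c).
Proof.
apply/exponential_polynomial_seqP; exists [:: (c, fun=> 0%N, 0)] => x.
rewrite big_seq1 /exp_monomial /pairing !big1 ?cexp0 ?mulr1 //= => j _.
by rewrite mxE mulr0.
Qed.

(** * Continuity of matrix products and of translates *)

Lemma continuous_mulmx (R : realType) (T : topologicalType) m p q
    (F : T -> 'M[R]_(m, p)) (B : 'M[R]_(p, q)) i j :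
  (forall k, continuous (fun x => F x i k)) ->
  continuous (fun x => (F x *m B) i j).
Proof.
move=> cF; under eq_fun do rewrite mxE.
apply: continuous_big => [|k _ x]; first exact: add_continuous.
by apply: cvgM; [exact: cF | exact: cvg_cst].
Qed.

Lemma continuous_shift (R : realType) d (g : 'rV[R]_d -> R) (y : 'rV[R]_d) :
  continuous g -> continuous (fun x : 'rV[R]_d => g (x + y)).
Proof.
move=> cg x.
apply: (@continuous_comp _ _ _ (fun x : 'rV[R]_d => x + y) g); last exact: cg.
exact: (cvgD cvg_id (cvg_cst _)).
Qed.

Lemma continuous_line (R : realType) d (g : 'rV[R]_d -> R) (x v : 'rV[R]_d) :
  continuous g -> continuous (fun t : R => g (x + t *: v)).
Proof.
move=> cg t.
apply: (@continuous_comp _ _ _ (fun t : R => x + t *: v) g); last exact: cg.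
exact: (cvgD (cvg_cst _) (cvgZ cvg_id (cvg_cst _))).
Qed.

(** * Finite-dimensional families stable under finitely many steps *)

Lemma leading_recurrence (K : fieldType) (n : nat) (a : 'I_n.+1 -> K) :
  (exists k, a k != 0) ->
  exists p (b : nat -> K), forall (V : lmodType K) (u : nat -> V),
    \sum_(k < n.+1) a k *: u k = 0 -> u p = \sum_(k < p) b k *: u k.
Proof.
(* [p] is the last index with a nonzero coefficient. It and [b] are fixed before [u], so one
   recurrence serves all base points. *)
move=> [k0 ak0]; case: (@arg_maxnP _ k0 (fun k => a k != 0) (@nat_of_ord n.+1) ak0) => p ap pmax.
exists p, (fun k => - (a (inord k) / a p)) => V u au0.
have pn := ltn_ord p.
have : \sum_(k < n.+1) a (inord k) *: u k = 0.
  by rewrite -[RHS]au0; apply: eq_bigr => k _; rewrite inord_val.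
rewrite -(big_mkord predT (fun k => a (inord k) *: u k)).
rewrite (big_cat_nat (n := p.+1)) //= (_ : \sum_(p.+1 <= k < n.+1) _ = 0).
  rewrite addr0 big_nat_recr //= inord_val big_mkord => /eqP.
  rewrite addrC addr_eq0 => /eqP apu.
  apply: (scalerI ap); rewrite apu scaler_sumr -sumrN; apply: eq_bigr => k _.
  by rewrite scalerA mulrN mulrCA divff // mulr1 scaleNr.
rewrite big_nat_cond big1 // => k /andP[/andP[pk kn] _].
have [->|ak] := eqVneq (a (inord k)) 0; first by rewrite scale0r.
by have := pmax _ ak; rewrite /= inordK // leqNgt pk.
Qed.

(* Adding a step [h] replaces [F] by the block of rows [F (x + h *+ k)], [k <= p];
   translation by [h] then acts through a companion matrix [C], while the old
   steps act on the other side, and the recurrences are inherited. *)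
Lemma finite_translation_family (R : realType) d n (a : 'I_n.+1 -> 'rV[R]_d -> R)
    (V : set 'rV[R]_d) (f : 'rV[R]_d -> R) (s : seq 'rV[R]_d) :
  (forall h, V h -> exists k, a k h != 0) ->
  continuous f ->
  (forall x h, V h -> \sum_(k < n.+1) a k h * f (x + h *+ k) = 0) ->
  (forall h, h \in s -> V h) ->
  exists m (F : 'rV[R]_d -> 'rV[R]_m) (w : 'cV[R]_m),
    [/\ forall i, continuous (fun x => F x 0 i),
        forall x, f x = (F x *m w) 0 0,
        forall h, h \in s -> exists A, forall x, F (x + h) = F x *m A &
        forall x h, V h -> \sum_(k < n.+1) a k h *: F (x + h *+ k) = 0].
Proof.
move=> aV cf feq; elim: s => [|h s IH] sV.
  exists 1%N, (fun x => (f x)%:M), 1%:M; split => //.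
  - by move=> i; under eq_fun do rewrite ord1 mxE eqxx mulr1n.
  - by move=> x; rewrite mulmx1 mxE eqxx mulr1n.
  - move=> x h /feq fx; apply/rowP => i; rewrite summxE !mxE -[RHS](fx x).
    by apply: eq_bigr => k _; rewrite !mxE ord1 eqxx mulr1n.
have {IH}[|m [F [w [cF fF FA Feq]]]] := IH.
  by move=> y ys; apply: sV; rewrite inE ys orbT.
have Vh : V h by apply: sV; rewrite inE eqxx.
have [p [b bP]] := leading_recurrence (aV _ Vh).
(* With [p.+1] rows, row 0, which is [F x], exists even when [p = 0]. *)
pose Q x : 'M[R]_(p.+1, m) := \matrix_(k < p.+1) F (x + h *+ k).
(* Rows before the last shift by one. The last row is the recurrence based at [x + h], whose term of
   index [j] is row [j.+1] of [Q x]. *)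
pose C : 'M[R]_p.+1 := \matrix_(k < p.+1)
  if (k < p)%N then delta_mx 0 (inord k.+1)
  else \sum_(j < p) b j *: delta_mx 0 (inord j.+1).
pose top := row (0 : 'I_p.+1) \o (vec_mx : 'rV[R]_(p.+1 * m) -> 'M[R]_(p.+1, m)).
have QD x : Q (x + h) = C *m Q x.
  apply/row_matrixP => k; rewrite row_mul !rowK -addrA -mulrS.
  have Qr (j : nat) : (j < p)%N ->
      delta_mx 0 (inord j.+1) *m Q x = F (x + h + h *+ j).
    by move=> jp; rewrite -rowE rowK inordK // -addrA -mulrS.
  case: ifPn => kp; first by rewrite Qr // -addrA -mulrS.
  have -> : k = p :> nat.
    by apply/eqP; rewrite eqn_leq -ltnS ltn_ord leqNgt.
  rewrite mulrS addrA (bP _ (fun j => F (x + h + h *+ j))) ?Feq //.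
  rewrite mulmx_suml; apply: eq_bigr => j _.
  by rewrite -scalemxAl Qr.
exists (p.+1 * m)%N, (fun x => mxvec (Q x)), (lin1_mx top *m w); split.
- move=> i; case/mxvec_indexP: i => k j.
  under eq_fun do rewrite mxvecE mxE.
  exact: (continuous_shift (g := fun y => F y 0 j)).
- move=> x; rewrite mulmxA mul_rV_lin1 /= mxvecK rowK mulr0n addr0.
  exact: fF.
- move=> y; rewrite inE => /orP[/eqP ->|ys].
    by exists (lin_mulmx C) => x; rewrite mul_vec_lin /= QD.
  have [A AP] := FA _ ys.
  exists (lin_mulmxr A) => x; rewrite mul_vec_lin /=; congr mxvec.
  by apply/row_matrixP => k; rewrite row_mul !rowK -AP addrAC.
- move=> x y Vy; under eq_bigr do rewrite -linearZ /=.
  rewrite -linear_sum /= -[RHS](linear0 mxvec); congr mxvec.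
  apply/row_matrixP => k; rewrite linear_sum /= linear0 -[RHS](Feq (x + h *+ k) _ Vy).
  by apply: eq_bigr => l _; rewrite linearZ /= rowK addrAC.
Qed.

(** Independent families of values have size at most [m]; one of maximal size spans, as a value
    outside its span could be added to it. *)
Lemma spanning_evaluations (K : fieldType) (T : Type) m (F : T -> 'rV[K]_m) :
  exists r (X : 'I_r -> T), row_free (\matrix_(j < r) F (X j)) /\
    forall x, (F x <= \matrix_(j < r) F (X j))%MS.
Proof.
pose P r := `[< exists X : 'I_r -> T, row_free (\matrix_(j < r) F (X j)) >].
have P0 : exists r, P r.
  exists 0%N; apply/asboolP; have X : 'I_0 -> T by case.
  by exists X; rewrite -row_leq_rank.
have Pm r : P r -> (r <= m)%N.
  by move=> /asboolP[X]; rewrite -row_leq_rank => /leq_trans; apply; exact: rank_leq_col.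
case: (ex_maxnP P0 Pm) => r /asboolP[X fX] rmax; exists r, X; split=> // x.
apply/negPn/negP => Fx; set B := \matrix_(j < r) _ in fX Fx.
suff /rmax : P r.+1 by rewrite ltnn.
apply/asboolP; exists (fun j => if unlift 0 j is Some i then X i else x).
have -> : \matrix_(j < r.+1) F (if unlift 0 j is Some i then X i else x) =
    col_mx (F x) B :> 'M[K]_(r.+1, m).
  apply/row_matrixP => j; rewrite rowK; case: unliftP => [i|] ->.
    have -> : lift 0 i = @rshift 1 r i by apply: val_inj.
    by symmetry; apply: (etrans (rowKd i (F x) B)); rewrite rowK.
  have -> : (0 : 'I_r.+1) = lshift r (0 : 'I_1) by apply: val_inj.
  by symmetry; apply: (etrans (rowKu 0 (F x) B)); rewrite row_id.
have : (B < col_mx (F x) B)%MS.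
  rewrite ltmxE -!addsmxE addsmxSr /=; apply: contra Fx.
  by apply: submx_trans; exact: addsmxSl.
rewrite ltmxErank => /andP[_]; rewrite -row_leq_rank => /(leq_ltn_trans _); apply.
by rewrite row_leq_rank.
Qed.

(** * Density of the subgroup generated by two incommensurable steps *)

(* Along with [s] and [sqrt 2 * s], the subgroup contains both multiples of
   [(sqrt 2 - 1) * s], since [sqrt 2 * (sqrt 2 - 1) = 2 - sqrt 2]; hence it
   contains arbitrarily small elements. *)
Lemma sqrt2_subgroup_dense (R : realType) (S : R -> Prop) (del : R) :
  0 < del -> S del -> S (Num.sqrt 2 * del) ->
  (forall s t, S s -> S t -> S (s - t)) ->
  forall t e : R, 0 < e -> exists2 s, S s & `|t - s| < e.
Proof.
move=> del0 Sd Sd2 SB t e e0.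
have S0 : S 0 by rewrite -(subrr del); exact: SB.
have SN s : S s -> S (- s) by rewrite -[- s]add0r; exact: SB.
have SD s u : S s -> S u -> S (s + u).
  by move=> Ss /SN Su; rewrite -[u]opprK; exact: SB.
have SM s n : S s -> S (s *+ n).
  by move=> Ss; elim: n => [|n IH]; rewrite ?mulr0n // mulrS; exact: SD.
have SZ s (n : int) : S s -> S (s *~ n).
  by case: n => n Ss; [exact: SM | apply: SN; exact: SM].
have sq2 : Num.sqrt 2 ^+ 2 = 2 :> R by rewrite sqr_sqrtr.
set r : R := Num.sqrt 2 in Sd2 sq2.
have r0 : 0 <= r by exact: sqrtr_ge0.
have [r1 r2] : 1 < r /\ r < 2 by split; nra.
have Sw k : S ((r - 1) ^+ k * del) /\ S (r * ((r - 1) ^+ k * del)).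
  elim: k => [|k [IH1 IH2]]; first by rewrite expr0 mul1r.
  rewrite exprS -mulrA; set w := _ ^+ k * del in IH1 IH2 *.
  have -> : (r - 1) * w = r * w - w by ring.
  split; first exact: SB.
  have -> : r * (r * w - w) = w *+ 2 - r * w.
    by rewrite mulrBr mulrA -expr2 sq2 mulr_natl.
  by apply: SB => //; exact: SM.
(* Since [r - 1] lies strictly between 0 and 1, its powers tend to 0. *)
have [k wk] : exists k, (r - 1) ^+ k * del < e.
  have : `|r - 1| < 1 by rewrite ger0_norm; lra.
  move=> /cvg_expr /cvgrPdist_lt /(_ (e / del)) [|k _ /(_ k (leqnn k))].
    by rewrite divr_gt0.
  rewrite /= sub0r normrN ger0_norm; last by apply: exprn_ge0; lra.
  by rewrite ltr_pdivlMr // => ?; exists k.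
have w0 : 0 < (r - 1) ^+ k * del by apply: mulr_gt0 => //; apply: exprn_gt0; lra.
have [Swk _] := Sw k; set w := _ ^+ k * del in wk w0 Swk.
(* The largest multiple of [w] not exceeding [t] misses it by less than [w], hence by less than
   [e]. *)
exists (w *~ Num.floor (t / w)); first exact: SZ.
have /andP[] := floor_itv (t / w).
rewrite ler_pdivlMr // ltr_pdivrMr // intrD mulrDl mul1r !mulrzl => lo hi.
by rewrite ger0_norm; lra.
Qed.

Lemma sqrt2_subgroup_eq0 (R : realType) (S : R -> Prop) (del : R) (g : R -> R) :
  0 < del -> S del -> S (Num.sqrt 2 * del) ->
  (forall s t, S s -> S t -> S (s - t)) ->
  continuous g -> (forall s, S s -> g s = 0) -> forall t, g t = 0.
Proof.
move=> del0 Sd Sd2 SB cg gS t; apply/eqP/negPn/negP => gt0.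
have /nbhs_ballP[e /= e0 be] : \forall s \near t, g s != 0.
  exact: (cvgr_neq0 _ (cg t)).
have [s Ss ts] := sqrt2_subgroup_dense del0 Sd Sd2 SB t e0.
by have := be s ts; rewrite (gS _ Ss) eqxx.
Qed.

(** * Translation matrices in coordinates, along lines and then along all axes *)

Section TranslationCocycle.
Variables (R : realType) (d r : nat) (c : 'rV[R]_d -> 'rV[R]_r).
Variable X : 'I_r -> 'rV[R]_d.
Hypothesis cc : forall i, continuous (fun x => c x 0 i).
Hypothesis cX : forall j, c (X j) = delta_mx 0 j.

(** As [c (X j)] is the [j]-th basis row, this is the only candidate for the matrix of translation
    by [y], whether or not one exists. It is continuous in [y]. *)
Let N y := \matrix_(j < r) c (X j + y).
Let G y := exists A, forall x, c (x + y) = c x *m A.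

Let GN y A : (forall x, c (x + y) = c x *m A) -> A = N y.
Proof.
by move=> cA; apply/row_matrixP => j; rewrite rowK cA cX -rowE.
Qed.

Lemma translation_matrixD y z : G y -> G z -> G (y + z).
Proof.
move=> [A cA] [B cB]; exists (A *m B) => x.
by rewrite addrA cB cA mulmxA.
Qed.

(* No backward recurrence is needed: [delta_mx 0 j = c (X j - y) *m A] for every
   [j] forces [A] to be invertible. *)
Lemma translation_matrixN y : G y -> G (- y).
Proof.
move=> [A cA].
have : (\matrix_(j < r) c (X j - y)) *m A = 1%:M.
  by apply/row_matrixP => j; rewrite row_mul rowK row1 -cA addrNK cX.
move=> /mulmx1_unit[_ uA]; exists (invmx A) => x.
by rewrite -[in RHS](addrNK y x) cA mulmxK.
Qed.

(** The [t] with [G (t *: v)] form a subgroup that is dense by the choice of the two steps, and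
    [c (x + t *: v) = c x *m N (t *: v)] is a closed condition on [t]. It therefore holds for every
    [t]. *)
Lemma line_exponential_sum1 (v : 'rV[R]_d) (del : R) :
  0 < del -> G (del *: v) -> G ((Num.sqrt 2 * del) *: v) ->
  exists M : R -> 'M[R]_r,
    (forall x t, c (x + t *: v) = c x *m M t) /\
    forall i j, exponential_sum1 (fun t => (M t i j)%:C).
Proof.
move=> del0 Gd Gd2; pose M t := N (t *: v).
have cM i j : continuous (fun t => M t i j).
  under eq_fun do rewrite mxE.
  exact: (continuous_line (g := fun y => c y 0 j)).
have cvM x t : c (x + t *: v) = c x *m M t.
  apply/rowP => i; apply/eqP; rewrite -subr_eq0; apply/eqP.
  pose g t := c (x + t *: v) 0 i - (c x *m M t) 0 i.
  apply: (@sqrt2_subgroup_eq0 _ (fun t => G (t *: v)) del g) => //.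
  - move=> s u Gs Gu; rewrite scalerBl; apply: translation_matrixD => //; exact: translation_matrixN.
  - move=> u; apply: cvgB.
      exact: (continuous_line (g := fun y => c y 0 i)).
    under eq_fun do rewrite mxE.
    rewrite mxE; apply: cvg_big => [|j _]; first exact: add_continuous.
    by apply: cvgM; [exact: cvg_cst | exact: cM].
  - by move=> s [A cA]; rewrite /g cA (GN cA) subrr.
(* Uniqueness of the translation matrix, [GN], yields the identity at 0 and the group law. *)
exists M; split=> //; apply: matrix_group_exponential_sum1 => //.
- symmetry; apply: (GN (y := 0 *: v)) => x.
  by rewrite scale0r addr0 mulmx1.
- move=> s t; symmetry; apply: GN => x.
  by rewrite scalerDl addrA !cvM mulmxA.
Qed.

(** The point [x] is reached from 0 one coordinate at a time: [trunc k x] keeps the first [k]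
    coordinates, and restoring the next one multiplies [c] by a matrix of one-variable exponential
    sums in that coordinate. *)
Lemma translation_exponential_polynomial (del : R) (i : 'I_r) :
  0 < del ->
  (forall j : 'I_d, G (del *: delta_mx 0 j)) ->
  (forall j : 'I_d, G ((Num.sqrt 2 * del) *: delta_mx 0 j)) ->
  exponential_polynomial (fun x => (c x 0 i)%:C).
Proof.
move=> del0 Gd Gd2.
pose trunc (k : nat) (x : 'rV[R]_d) : 'rV[R]_d :=
  \row_(j < d) (if (j < k)%N then x 0 j else 0).
have step k : (k <= d)%N ->
    forall i, exponential_polynomial (fun x => (c (trunc k x) 0 i)%:C).
  elim: k => [|k IH] kd l.
    have -> : (fun x => (c (trunc 0%N x) 0 l)%:C) = (fun=> (c 0 0 l)%:C).
      apply/funext => x; congr ((c _ _ _)%:C).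
      by apply/rowP => j; rewrite !mxE.
    exact: exponential_polynomial_cst.
  pose k' := Ordinal kd.
  have [M [cM eM]] := line_exponential_sum1 del0 (Gd k') (Gd2 k').
  have -> : (fun x => (c (trunc k.+1 x) 0 l)%:C) =
      (fun x => \sum_j (c (trunc k x) 0 j)%:C * (M (x 0 k') j l)%:C).
    apply/funext => x; under eq_bigr do rewrite -rmorphM.
    rewrite -rmorph_sum /=; congr (_%:C).
    have -> : trunc k.+1 x = trunc k x + x 0 k' *: delta_mx 0 k'.
      apply/rowP => j; rewrite !mxE eqxx /= -val_eqE /= ltnS leq_eqVlt.
      case: eqVneq => [jk|_] /=; last by rewrite mulr0 addr0.
      rewrite jk ltnn mulr1 add0r; congr (x 0 _); exact: val_inj.
    by rewrite cM mxE.
  apply: (exponential_polynomial_sum _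
    (g := fun j x => (c (trunc k x) 0 j)%:C * (M (x 0 k') j l)%:C)) => j.
  apply: exponential_polynomialM; first exact: (IH (ltnW kd)).
  exact: (exponential_polynomial_coord k' (eM j l)).
have := step d (leqnn d) i; congr exponential_polynomial.
apply/funext => x; congr ((c _ _ _)%:C).
by apply/rowP => j; rewrite mxE ltn_ord.
Qed.
End TranslationCocycle.

(** * Choice of the steps and conclusion *)

Lemma small_parallel_steps (R : realType) d (V : set 'rV[R]_d) (h0 : 'rV[R]_d) :
  nbhs h0 V -> exists2 del : R, 0 < del & forall j : 'I_d,
    V (h0 + del *: delta_mx 0 j) /\ V (h0 + (Num.sqrt 2 * del) *: delta_mx 0 j).
Proof.
move=> Vh0.
(* Applied with [c = 1] and [c = Num.sqrt 2]; there are finitely many axes, so one small [t] serves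
   them all. *)
have Vj (c : R) (j : 'I_d) :
    \forall t \near (0 : R)^'+, V (h0 + (c * t) *: delta_mx 0 j).
  have cl : (h0 + (c * t) *: delta_mx 0 j : 'rV[R]_d) @[t --> (0 : R)] -->
      (h0 + (c * 0) *: delta_mx 0 j : 'rV[R]_d).
    exact: (cvgD (cvg_cst _) (cvgZ (cvgM (cvg_cst _) cvg_id) (cvg_cst _))).
  have := cvg_at_right_filter cl; rewrite mulr0 scale0r addr0 => {}cl.
  exact: cl.
have [del [del0 V1 V2]] : exists del : R, [/\ 0 < del,
    forall j : 'I_d, V (h0 + (1 * del) *: delta_mx 0 j) &
    forall j : 'I_d, V (h0 + (Num.sqrt 2 * del) *: delta_mx 0 j)].
  near (0 : R)^'+ => t; exists t; split => //.
  - by near: t; apply: filter_forall => j; exact: Vj.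
  - by near: t; apply: filter_forall => j; exact: Vj.
by exists del => // j; split=> //; rewrite -[del]mul1r.
Unshelve. all: by end_near. Qed.

Unset Implicit Arguments.
Set Strict Implicit.
Set Printing Implicit Defensive.

Theorem corollary2p3 (R : realType) (d n : nat) (hd : (1 <= d)%N)
    (f : 'rV[R]_d -> R) (hf : continuous f)
    (U : set 'rV[R]_d) (hU : open U)
    (a : 'I_n.+1 -> 'rV[R]_d -> R)
    (ha : forall k : 'I_n.+1, {within U, continuous (a k)})
    (ha0 : exists h : 'rV[R]_d, U h /\ exists k : 'I_n.+1, a k h <> 0)
    (hfeq : forall x h : 'rV[R]_d, U h ->
       \sum_(k < n.+1) a k h * f (x + h *+ k) = 0) :
  exponential_polynomial (fun x : 'rV[R]_d => (f x)%:C).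
Proof.
have [h0 [Uh0 [k0 /eqP ak0]]] := ha0.
(* On [V] the recurrence is nontrivial, and continuity of [a k0] makes [V] a neighbourhood of
   [h0]. *)
pose V : set 'rV[R]_d := [set h | U h /\ exists k, a k h != 0].
have V0 : nbhs h0 V.
  have U0 : nbhs h0 U by exact: open_nbhs_nbhs.
  have ca : {for h0, continuous (a k0)}.
    have := ha k0; rewrite continuous_open_subspace // => /(_ h0); apply.
    exact: mem_set.
  have a0 : \forall h \near h0, a k0 h != 0 by exact: (cvgr_neq0 _ ca).
  by apply: filterS2 U0 a0 => h Uh ah; split=> //; exists k0.
have [del del0 Vdel] := small_parallel_steps V0.
(* Steps must lie in [V], which may stay away from 0; only their differences with [h0] are small
   multiples of the axis vectors. *)
pose steps := h0 :: [seq h0 + del *: delta_mx 0 j | j : 'I_d] ++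
  [seq h0 + (Num.sqrt 2 * del) *: delta_mx 0 j | j : 'I_d].
have Vsteps h : h \in steps -> V h.
  rewrite inE mem_cat => /or3P[/eqP ->|/codomP[j ->]|/codomP[j ->]].
  - exact: nbhs_singleton V0.
  - by have [] := Vdel j.
  - by have [] := Vdel j.
have [m [F [w [cF fF FA _]]]] := finite_translation_family
  (fun h (Vh : V h) => Vh.2) hf (fun x h (Vh : V h) => hfeq x h Vh.1) Vsteps.
have [r [X [freeB FB]]] := spanning_evaluations F.
set B := \matrix_(j < r) F (X j) in freeB FB.
(* Coordinates in the basis of rows of [B]: spanning gives [F x = c x *m B], and row-freeness gives
   [c (X j) = delta_mx 0 j]. *)
pose c x := F x *m pinvmx B.
have FcB x : F x = c x *m B by rewrite /c mulmxKpV.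
have cc i : continuous (fun x => c x 0 i) by exact: continuous_mulmx.
have cX j : c (X j) = delta_mx 0 j.
  by rewrite /c -(rowK (fun j => F (X j))) -row_mul mulmxVp // row1.
have cA h : h \in steps -> exists A, forall x, c (x + h) = c x *m A.
  move=> /FA[A AP]; exists (B *m A *m pinvmx B) => x.
  by rewrite mulmxA (mulmxA (c x)) -FcB -AP.
(* Translation by [h] is the step [h0 + h] followed by the inverse of the step [h0]. *)
have cdiff h : h0 + h \in steps -> exists A, forall x, c (x + h) = c x *m A.
  move=> /cA h0h; have -> : h = (h0 + h) + - h0 by rewrite addrAC subrr add0r.
  apply: (translation_matrixD h0h); apply: (translation_matrixN cX).
  by apply: cA; rewrite inE eqxx.
(* [f] is a fixed linear combination of the coordinates of [c], with coefficients [B *m w]. *)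
have -> : (fun x => (f x)%:C) =
    (fun x => \sum_i (c x 0 i)%:C * ((B *m w) i 0)%:C).
  apply/funext => x; under eq_bigr do rewrite -rmorphM.
  by rewrite -rmorph_sum /= fF FcB -mulmxA mxE.
apply: (exponential_polynomial_sum _
  (g := fun i x => (c x 0 i)%:C * ((B *m w) i 0)%:C)) => i.
apply: exponential_polynomialM; last exact: exponential_polynomial_cst.
apply: (translation_exponential_polynomial cc cX _ del0) => j; apply: cdiff.
- by rewrite inE mem_cat; rewrite codom_f orbT.
- by rewrite inE mem_cat; rewrite codom_f !orbT.
Qed.
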